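(* Let $A$ be any $(d+1)\times(d+1)$ matrix. For $0\le j\le d$ let $\Lambda_j$ be the diagonal matrix formed from column $j$ of $A$, that is, $(\Lambda_j)_{ii}=A_{ij}$. Let $$\Lambda=\sum_{j=0}^d v_j\Lambda_j,$$ where $v=(v_0,\dots,v_d)$ are commuting indeterminates. Then for every $N\ge 0$ and every multi-index $n$ with $|n|=N$, the coefficient of $v^n$ in the degree $N$ symmetric power $\bar\Lambda$ is the diagonal matrix whose diagonal entries are the entries of the $n$-th column of $\bar A$ (i.e. its $(m,m)$ entry is $\bar A_{mn}$).
   Context: Matrices have rows and columns indexed by $0,1,\dots,d$. Multi-indices are tuples $n=(n_0,\dots,n_d)$ of nonnegative integers, $|n|=\sum_i n_i$, $x^n=x_0^{n_0}\cdots x_d^{n_d}$. For an integer $N\ge 0$, the symmetric power $\bar A$ of a $(d+1)\times(d+1)$ matrix $A$ in degree $N$ is the matrix indexed by multi-indices $m,n$ with $|m|=|n|=N$ defined by $(Ax)^m=\sum_{|n|=N}\bar A_{mn}x^n$, where $(Ax)_i=\sum_j A_{ij}x_j$. The same definition is used for matrices whose entries are polynomials in the $v_j$. *)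

(* Defs.v *)
From mathcomp Require Import all_boot all_order all_algebra.
From mathcomp Require Import mpoly.

Set Implicit Arguments.
Unset Strict Implicit.
Unset Printing Implicit Defensive.

Import GRing.Theory.

Local Open Scope ring_scope.

(* Multi-indices n = (n_0, ..., n_d) with |n| = N. The bound in the carrier
   is implied by |n| = N; it only makes the type finite. *)
Definition midx (d N : nat) := {n : 'X_{1..d.+1 < N.+1} | mdeg n == N}.

Definition multinom_of_midx (d N : nat) (n : midx d N) : 'X_{1..d.+1} :=
  bmnm (val n).
Coercion multinom_of_midx : midx >-> multinom.

(* (A x)_i as a polynomial in the indeterminates x_0, ..., x_d *)
Definition linform (R : comNzRingType) (d : nat) (A : 'M[R]_d.+1)
    (i : 'I_d.+1) : {mpoly R[d.+1]} :=
  \sum_(j < d.+1) A i j *: 'X_j.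

(* (A x)^m *)
Definition linform_monomial (R : comNzRingType) (d : nat) (A : 'M[R]_d.+1)
    (m : 'X_{1..d.+1}) : {mpoly R[d.+1]} :=
  \prod_(i < d.+1) linform A i ^+ m i.

(* The matrix whose rows and columns are indexed by the multi-indices of degree
   N, through the bijection enum_rank / enum_val between midx d N and
   'I_#|{: midx d N}|; sympowP below is its defining property. *)
Definition sympow (R : comNzRingType) (d N : nat) (A : 'M[R]_d.+1) :
    'M[R]_#|{: midx d N}| :=
  \matrix_(m < #|{: midx d N}|, n < #|{: midx d N}|)
    (linform_monomial A (enum_val m : midx d N))@_(enum_val n : midx d N).

Lemma midx_mdeg (d N : nat) (n : midx d N) : mdeg n = N.
Proof. exact/eqP/(valP n). Qed.

Lemma midx_inj (d N : nat) : injective (@multinom_of_midx d N).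
Proof. by move=> m n mn; apply/val_inj/val_inj. Qed.

Lemma midx_surj (d N : nat) (n : 'X_{1..d.+1}) :
  mdeg n = N -> exists n' : midx d N, n = n'.
Proof.
move=> nN; have ltnN : (mdeg n < N.+1)%N by rewrite nN.
have eqnN : mdeg (BMultinom ltnN) == N by rewrite /= nN.
by exists (exist _ (BMultinom ltnN) eqnN).
Qed.

Lemma linform_monomial_homog (R : comNzRingType) (d : nat) (A : 'M[R]_d.+1)
    (m : 'X_{1..d.+1}) :
  linform_monomial A m \is (mdeg m).-homog.
Proof.
rewrite mdegE /linform_monomial.
apply: (big_ind2 (fun (p : {mpoly R[d.+1]}) k => p \is k.-homog)).
- exact: dhomog1.
- by move=> p k q l; apply: dhomogM.
move=> i _; rewrite -[X in X.-homog]mul1n; apply: dhomogMn.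
apply: rpred_sum => j _; apply: rpredZ.
by rewrite dhomogX /= mdeg1.
Qed.

Lemma mcoeff_midx_sum (R : comNzRingType) (d N : nat) (c : midx d N -> R)
    (n : midx d N) :
  (\sum_(k : midx d N) c k *: 'X_[k])@_n = c n.
Proof.
rewrite raddf_sum /= (bigD1 n) //= big1 => [|k /negPf kn].
  by rewrite mcoeffZ mcoeffX eqxx mulr1 addr0.
by rewrite mcoeffZ mcoeffX (inj_eq (@midx_inj d N)) kn mulr0.
Qed.

Lemma sympowP (R : comNzRingType) (d N : nat) (A : 'M[R]_d.+1)
    (B : 'M[R]_#|{: midx d N}|) :
  (forall m : midx d N,
     linform_monomial A m =
     \sum_(n : midx d N) B (enum_rank m) (enum_rank n) *: 'X_[n])
  <-> B = sympow N A.
Proof.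
split=> [defB | -> m].
  apply/matrixP=> m n; rewrite mxE defB mcoeff_midx_sum.
  by rewrite !enum_valK.
apply/mpolyP=> n; have [nN | nN] := eqVneq (mdeg n) N.
  by have [n' ->] := midx_surj nN; rewrite mcoeff_midx_sum mxE !enum_rankK.
have /dhomog_nemf_coeff -> /= := linform_monomial_homog A m; last first.
  by rewrite midx_mdeg.
rewrite raddf_sum /= big1 // => k _; rewrite mcoeffZ mcoeffX.
by case: eqP => [kn | _]; [rewrite -kn midx_mdeg eqxx in nN | rewrite mulr0].
Qed.

(* Main.v *)
Require Import Defs.
From mathcomp Require Import all_boot all_order all_algebra.
From mathcomp Require Import mpoly.

Import GRing.Theory.

(** A diagonal matrix [diag_mx D] sends [x_i] to [D_i x_i], so it sends the
    monomial [x^m] to [D^m x^m]: its symmetric power is diagonal, with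
    diagonal entries [D^m].  The matrix [Lambda] is diagonal, and its [i]-th
    entry [\sum_j A_ij v_j] is the [i]-th linear form [(A v)_i] of [A], read in
    the variables [v].  Hence the [(m, m)] entry of its symmetric power is
    [(A v)^m], whose [v^n] coefficient is by definition the [(m, n)] entry of
    the symmetric power of [A]. *)

Local Open Scope ring_scope.

Lemma linform_diag (S : comNzRingType) (d : nat) (D : 'rV[S]_d.+1)
    (i : 'I_d.+1) :
  linform (diag_mx D) i = D 0 i *: 'X_i.
Proof.
rewrite /linform (bigD1 i) //= big1 ?addr0; first by rewrite mxE eqxx.
by move=> j /negPf ji; rewrite mxE eq_sym ji scale0r.
Qed.

Lemma linform_monomial_diag (S : comNzRingType) (d : nat) (D : 'rV[S]_d.+1)
    (m : 'X_{1..d.+1}) :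
  linform_monomial (diag_mx D) m = (\prod_i D 0 i ^+ m i) *: 'X_[m].
Proof.
rewrite /linform_monomial mpolyXE_id -scaler_prod.
by apply: eq_bigr => i _; rewrite linform_diag exprZn.
Qed.

Lemma sympow_diag (S : comNzRingType) (d N : nat) (D : 'rV[S]_d.+1) :
  sympow N (diag_mx D)
  = diag_mx (\row_m \prod_i D 0 i ^+ (enum_val m : midx d N) i).
Proof.
apply/matrixP=> m k; rewrite !mxE linform_monomial_diag mcoeffZ mcoeffX.
by rewrite (inj_eq (@midx_inj d N)) (inj_eq enum_val_inj) mulr_natr.
Qed.

(** The two sets of variables meet here: the diagonal entries of [Lambda] are
    scalars for the variables [x], and as polynomials in [v] they are the
    linear forms of [A]. *)
Lemma sum_var_column_diag (R : comNzRingType) (d : nat) (A : 'M[R]_d.+1) :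
  \sum_(j < d.+1)
     'X_j *: map_mx (@mpolyC d.+1 R) (diag_mx (\row_i A i j))
  = diag_mx (\row_i linform A i).
Proof.
apply/matrixP=> i k; rewrite summxE !mxE /linform -sumrMnl.
apply: eq_bigr => j _; rewrite !mxE raddfMn /= mulrnAr.
by rewrite mulrC mul_mpolyC.
Qed.

Theorem theorem3p1 (R : comNzRingType) (d : nat) (A : 'M[R]_d.+1) (N : nat)
    (n : midx d N) :
  let Lambda_ (j : 'I_d.+1) : 'M[R]_d.+1 := diag_mx (\row_i A i j) in
  let Lambda : 'M[{mpoly R[d.+1]}]_d.+1 :=
    \sum_(j < d.+1) 'X_j *: map_mx (@mpolyC d.+1 R) (Lambda_ j) in
  map_mx (mcoeff n) (sympow N Lambda)
  = diag_mx (\row_m sympow N A m (enum_rank n)).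
Proof.
move=> Lambda_ Lambda; rewrite /Lambda /Lambda_ sum_var_column_diag sympow_diag.
apply/matrixP=> m k; rewrite !mxE enum_rankK raddfMn /=.
by congr (_@_n *+ _); apply: eq_bigr => i _; rewrite mxE.
Qed.
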